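(* Consider the following nested lattice code construction of Nazer and Gastpar. First, pick an $n$-dimensional real lattice $\Lambda'_r$, with generator matrix $\boldsymbol{G}_{\Lambda'_r}\in\mathbb{R}^{n\times n}$, that is simultaneously good for covering, quantization, and AWGN channel coding, and let $$\Lambda'=\{\boldsymbol{r}\,\boldsymbol{G}_{\Lambda'_r}=\mathrm{Re}\{\boldsymbol{r}\}\boldsymbol{G}_{\Lambda'_r}+i\,\mathrm{Im}\{\boldsymbol{r}\}\boldsymbol{G}_{\Lambda'_r} : \boldsymbol{r}\in\mathbb{Z}[i]^n\}$$ be the corresponding $\mathbb{Z}[i]$-lattice. Second, let $p$ be a prime in $\mathbb{Z}$, and draw a matrix $\boldsymbol{B}\in\mathbb{Z}^{k\times(n-k)}$ with every entry chosen i.i.d. according to the uniform distribution over $\{0,1,\dots,p-1\}$. Put $$\boldsymbol{G}_{\Lambda_r}=p^{-1}\begin{bmatrix}\boldsymbol{I}_k & \boldsymbol{B}\\ \boldsymbol{0}_{(n-k)\times k} & p\,\boldsymbol{I}_{n-k}\end{bmatrix}\boldsymbol{G}_{\Lambda'_r}$$ and construct the $\mathbb{Z}[i]$-lattice $$\Lambda=\{\boldsymbol{r}\,\boldsymbol{G}_{\Lambda_r}=\mathrm{Re}\{\boldsymbol{r}\}\boldsymbol{G}_{\Lambda_r}+i\,\mathrm{Im}\{\boldsymbol{r}\}\boldsymbol{G}_{\Lambda_r} : \boldsymbol{r}\in\mathbb{Z}[i]^n\}.$$ Then $\boldsymbol{G}_{\Lambda'_r}=\boldsymbol{J}\,\boldsymbol{G}_{\Lambda_r}$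 with $$\boldsymbol{J}=\begin{bmatrix}p\,\boldsymbol{I}_k & -\boldsymbol{B}\\ \boldsymbol{0}_{(n-k)\times k} & \boldsymbol{I}_{n-k}\end{bmatrix},$$ whose entries lie in $\mathbb{Z}[i]$; hence $\Lambda'$ is a sublattice of $\Lambda$. Moreover, $$\Lambda/\Lambda'\cong(\mathbb{Z}[i]/(p))^k .$$ Consequently, if $p$ is also a prime in $\mathbb{Z}[i]$, then the field size (the size of the field $\mathbb{Z}[i]/(p)$ over which $\Lambda/\Lambda'$ is a vector space) is $p^2$ rather than $p$. In particular, this larger field is obtained by setting the prime $p\equiv 3 \pmod 4$, since such prime numbers are also primes in $\mathbb{Z}[i]$.
   Context: Vectors are row vectors, and $k\le n$ are positive integers. $\mathbb{Z}[i]$ is the ring of Gaussian integers. A $\mathbb{Z}[i]$-lattice in $\mathbb{C}^n$ is the set of all $\mathbb{Z}[i]$-linear combinations of $n$ linearly independent vectors of $\mathbb{C}^n$, these vectors being the rows of a generator matrix; a sublattice of $\Lambda$ is a subset that is itself a $\mathbb{Z}[i]$-lattice. A real lattice $\Lambda'_r$ with generator matrix $\boldsymbol{G}_{\Lambda'_r}$ is the set of all $\mathbb{Z}$-linear combinations of the (linearly independent) rows of $\boldsymbol{G}_{\Lambda'_r}$. $\Lambda/\Lambda'$ is the quotient $\mathbb{Z}[i]$-module and $\cong$ denotes isomorphism of $\mathbb{Z}[i]$-modules. $\boldsymbol{I}_k$ is the $k\times k$ identity matrix. ''Good for covering, quantization, and AWGN channel coding'' is the usual asymptotic terminology for sequences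 of lattices of growing dimension: respectively, the ratio of covering radius to effective radius tends to $1$; the normalized second moment tends to $1/(2\pi e)$; and, under i.i.d. Gaussian noise, the probability that the noise leaves the Voronoi region decays exponentially in the dimension for every fixed volume-to-noise ratio above $2\pi e$. *)

(* Defs.v *)
From HB Require Import structures.
From mathcomp Require Import all_boot all_order all_algebra.
From mathcomp Require Import complex.
From mathcomp Require Import all_classical all_reals all_analysis.

Set Implicit Arguments.
Unset Strict Implicit.
Unset Printing Implicit Defensive.

Import Order.TTheory GRing.Theory Num.Theory.
Import numFieldNormedType.Exports.

Local Open Scope classical_set_scope.
Local Open Scope ring_scope.
Local Open Scope complex_scope.

Section GaussianIntegers.
Variable R : realType.

Definition gaussian : {pred R[i]} :=
  fun z => (complex.Re z \is a Num.int) && (complex.Im z \is a Num.int).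

Fact gaussian_subring_closed : subring_closed gaussian.
Proof.
split=> [|[a b] [c d] /andP[? ?] /andP[? ?]|[a b] [c d] /andP[? ?] /andP[? ?]].
- by apply/andP; split; rewrite /= ?rpred1 ?rpred0.
- by apply/andP; split; rewrite /= rpredB.
- by apply/andP; split; rewrite /= ?rpredB ?rpredD ?rpredM.
Qed.

HB.instance Definition _ :=
  GRing.isSubringClosed.Build R[i] gaussian gaussian_subring_closed.

Record Zi := MkZi { zi_val :> R[i]; _ : zi_val \in gaussian }.

HB.instance Definition _ := [isSub for zi_val].
HB.instance Definition _ := [Choice of Zi by <:].
HB.instance Definition _ := [SubChoice_isSubComNzRing of Zi by <:].

End GaussianIntegers.

Section RingNotions.
Variable A : comNzRingType.

Definition divides (a b : A) : Prop := exists c, b = c * a.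

Definition prime_element (q : A) : Prop :=
  [/\ q != 0, ~ divides q 1
    & forall a b, divides q (a * b) -> divides q a \/ divides q b].

Definition is_field : Prop := forall x : A, x != 0 -> exists y, y * x = 1.

Definition is_module_action (V : zmodType) (act : A -> V -> V) : Prop :=
  [/\ forall a b v, act a (act b v) = act (a * b) v,
      forall v, act 1 v = v,
      forall a u v, act a (u + v) = act a u + act a v
    & forall a b v, act (a + b) v = act a v + act b v].

End RingNotions.

Section QuotientModule.
Variables (A : pzRingType) (V : lmodType A) (N : submodClosed V).
Local Open Scope quotient_scope.

Fact submod_oppr_closed : oppr_closed N.
Proof. by move=> v; rewrite -scaleN1r; exact: rpredZ. Qed.

Definition submod_zmod : zmodClosed V :=
  HB.pack (GRing.SubmodClosed.sort N) (GRing.isOppClosed.Build V N submod_oppr_closed).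

Definition module_quot : Type := Quotient.quot submod_zmod.

HB.instance Definition _ := GRing.Zmodule.on module_quot.

Definition module_pi (v : V) : module_quot := \pi_(Quotient.quot submod_zmod) v.

Definition module_quot_scale (a : A) (q : module_quot) : module_quot :=
  module_pi (a *: repr (q : Quotient.quot submod_zmod)).

Lemma module_pi_eqE u v : (module_pi u == module_pi v) = (u - v \in N).
Proof. by rewrite -[RHS]/(u - v \in submod_zmod) Quotient.idealrBE. Qed.

Lemma module_pi_is_additive : {morph module_pi : u v / u + v}.
Proof. by move=> u v; exact: (raddfD \pi_(Quotient.quot submod_zmod)). Qed.

Lemma module_piZ a v : module_quot_scale a (module_pi v) = module_pi (a *: v).
Proof.
apply/eqP; rewrite module_pi_eqE -scalerBr rpredZ //.
by rewrite -module_pi_eqE /module_pi reprK.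
Qed.

Lemma module_pi_surj (q : module_quot) : exists v, q = module_pi v.
Proof. by exists (repr (q : Quotient.quot submod_zmod)); rewrite /module_pi reprK. Qed.

Fact module_quot_scaleA a b q :
  module_quot_scale a (module_quot_scale b q) = module_quot_scale (a * b) q.
Proof. by case: (module_pi_surj q) => v ->; rewrite !module_piZ scalerA. Qed.

Fact module_quot_scale1 : left_id 1 module_quot_scale.
Proof. by move=> q; case: (module_pi_surj q) => v ->; rewrite module_piZ scale1r. Qed.

Fact module_quot_scaleDr : right_distributive module_quot_scale +%R.
Proof.
move=> a q r; case: (module_pi_surj q) (module_pi_surj r) => u -> [v ->].
by rewrite -module_pi_is_additive !module_piZ scalerDr module_pi_is_additive.
Qed.

Fact module_quot_scaleDl q :
  {morph module_quot_scale^~ q : a b / a + b}.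
Proof.
move=> a b; case: (module_pi_surj q) => v ->.
by rewrite !module_piZ scalerDl module_pi_is_additive.
Qed.

HB.instance Definition _ := GRing.Zmodule_isLmodule.Build A module_quot
  module_quot_scaleA module_quot_scale1 module_quot_scaleDr
  module_quot_scaleDl.

End QuotientModule.

Section GaussianModP.
Variable R : realType.
Local Notation Zi := (Zi R).

Definition zi_ideal (p : nat) (_ : prime p) : {pred Zi} :=
  fun a => `[< divides (p%:R : Zi) a >].

Section Fixed.
Variables (p : nat) (p_prime : prime p).

Fact zi_idealr_closed : idealr_closed (zi_ideal p_prime).
Proof.
split; rewrite ?unfold_in.
- by apply/asboolP; exists 0; rewrite mul0r.
- apply/asboolPn => -[c /(congr1 val)].
  rewrite rmorphM rmorph_nat rmorph1 /=; case: c => -[a b] /= /[dup].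
  rewrite {1}unfold_in /= => /andP[/intrP[m ->] _] _.
  rewrite -[p%:R](rmorph_nat (real_complex R)) /=.
  case=> /esym; rewrite mulr0 subr0 -[p%:R]/((p%:Z)%:~R) -intrM -[RHS]/(1%:~R).
  move/intr_inj/(congr1 absz); rewrite abszM /= => /eqP.
  by rewrite muln_eq1 => /andP[_ /eqP p1]; move: (p_prime); rewrite p1.
- move=> a u v; rewrite !unfold_in => /asboolP[c ->] /asboolP[d ->].
  by apply/asboolP; exists (a * c + d); rewrite mulrDl mulrA.
Qed.

HB.instance Definition _ :=
  isIdealr.Build Zi (zi_ideal p_prime) zi_idealr_closed.

Definition Zi_mod : Type := {ideal_quot (zi_ideal p_prime)}.

HB.instance Definition _ := GRing.ComNzRing.on Zi_mod.

Definition Zi_mod_pi (a : Zi) : Zi_mod :=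
  (\pi_({ideal_quot (zi_ideal p_prime)}) a)%qT.

Fact Zi_mod_pi_zmod : zmod_morphism Zi_mod_pi.
Proof. exact: (raddfB (\pi_({ideal_quot (zi_ideal p_prime)}))%qT). Qed.

Fact Zi_mod_pi_monoid : monoid_morphism Zi_mod_pi.
Proof.
split; first exact: (rmorph1 (\pi_({ideal_quot (zi_ideal p_prime)}))%qT).
exact: (rmorphM (\pi_({ideal_quot (zi_ideal p_prime)}))%qT).
Qed.

HB.instance Definition _ :=
  GRing.isZmodMorphism.Build Zi Zi_mod Zi_mod_pi Zi_mod_pi_zmod.
HB.instance Definition _ :=
  GRing.isMonoidMorphism.Build Zi Zi_mod Zi_mod_pi Zi_mod_pi_monoid.

Definition Zi_mod_scale (a : Zi) (x : Zi_mod) : Zi_mod := Zi_mod_pi a * x.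

Fact Zi_mod_scaleA a b x :
  Zi_mod_scale a (Zi_mod_scale b x) = Zi_mod_scale (a * b) x.
Proof. by rewrite /Zi_mod_scale rmorphM mulrA. Qed.

Fact Zi_mod_scale1 : left_id 1 Zi_mod_scale.
Proof. by move=> x; rewrite /Zi_mod_scale rmorph1 mul1r. Qed.

Fact Zi_mod_scaleDr : right_distributive Zi_mod_scale +%R.
Proof. by move=> a x y; rewrite /Zi_mod_scale mulrDr. Qed.

Fact Zi_mod_scaleDl x : {morph Zi_mod_scale^~ x : a b / a + b}.
Proof. by move=> a b; rewrite /Zi_mod_scale rmorphD mulrDl. Qed.

HB.instance Definition _ := GRing.Zmodule_isLmodule.Build Zi Zi_mod
  Zi_mod_scaleA Zi_mod_scale1 Zi_mod_scaleDr Zi_mod_scaleDl.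

End Fixed.
End GaussianModP.

Section ComplexLattices.
Variables (R : realType) (n : nat).
Local Notation Zi := (Zi R).

(* C^n with scalars restricted to Z[i]; hence a type distinct from 'rV[R[i]]_n. *)
Definition cvec : Type := 'rV[R[i]]_n.

HB.instance Definition _ := GRing.Zmodule.on cvec.

Definition cvec_scale (a : Zi) (v : cvec) : cvec :=
  (val a : R[i]) *: (v : 'rV[R[i]]_n).

Fact cvec_scaleA a b v : cvec_scale a (cvec_scale b v) = cvec_scale (a * b) v.
Proof. by rewrite /cvec_scale scalerA. Qed.

Fact cvec_scale1 : left_id 1 cvec_scale.
Proof. by move=> v; rewrite /cvec_scale rmorph1 scale1r. Qed.

Fact cvec_scaleDr : right_distributive cvec_scale +%R.
Proof. by move=> a u v; rewrite /cvec_scale scalerDr. Qed.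

Fact cvec_scaleDl v : {morph cvec_scale^~ v : a b / a + b}.
Proof. by move=> a b; rewrite /cvec_scale rmorphD scalerDl. Qed.

HB.instance Definition _ := GRing.Zmodule_isLmodule.Build Zi cvec
  cvec_scaleA cvec_scale1 cvec_scaleDr cvec_scaleDl.

Definition zi_span (G : 'M[R[i]]_n) : {pred cvec} :=
  fun x => `[< exists r : 'rV[Zi]_n, x = map_mx val r *m G >].

Definition is_zi_lattice (L : {pred cvec}) : Prop :=
  exists2 G : 'M[R[i]]_n, row_free G & L =i zi_span G.

Definition is_zi_sublattice (L' L : {pred cvec}) : Prop :=
  is_zi_lattice L' /\ {subset L' <= L}.

Fact zi_span_submod_closed G : submod_closed (zi_span G).
Proof.
split; first by apply/asboolP; exists 0; rewrite map_mx0 mul0mx.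
move=> a x y /asboolP[r ->] /asboolP[s ->]; apply/asboolP.
by exists (a *: r + s); rewrite map_mxD map_mxZ mulmxDl -scalemxAl.
Qed.

HB.instance Definition _ G :=
  GRing.isSubmodClosed.Build Zi cvec (zi_span G) (zi_span_submod_closed G).

Record lattice_module (G : 'M[R[i]]_n) :=
  LatticeModule { lattice_vec :> cvec; _ : lattice_vec \in zi_span G }.

HB.instance Definition _ G := [isSub for @lattice_vec G].
HB.instance Definition _ G := [Choice of lattice_module G by <:].
HB.instance Definition _ G := [SubChoice_isSubLmodule of lattice_module G by <:].

Definition inner_lattice (G G' : 'M[R[i]]_n) : {pred lattice_module G} :=
  fun x => val x \in zi_span G'.

Fact inner_lattice_submod_closed G G' : submod_closed (inner_lattice (G:=G) G').
Proof.
split.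
  rewrite -[_ \in _]/(val (0 : lattice_module G) \in zi_span G').
  by rewrite raddf0 rpred0.
move=> a x y xG' yG'.
rewrite -[_ \in _]/(val (a *: x + y) \in zi_span G').
by rewrite linearP /= rpredD // rpredZ.
Qed.

HB.instance Definition _ G G' :=
  GRing.isSubmodClosed.Build Zi (lattice_module G) (inner_lattice (G:=G) G')
    (inner_lattice_submod_closed G G').

(* L/L' for L, L' generated by G, G'; it is meant for L' included in L, and is
   L/(L :&: L') in general. *)
Definition lattice_quot (G G' : 'M[R[i]]_n) : Type :=
  module_quot (inner_lattice (G:=G) G').

HB.instance Definition _ G G' := GRing.Lmodule.on (lattice_quot G G').

End ComplexLattices.

Definition complexify (R : realType) (m n : nat) (G : 'M[R]_(m, n)) :
  'M[R[i]]_(m, n) := map_mx (real_complex R) G.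

Lemma mul_complexify (R : realType) (n : nat) (r : 'rV[R[i]]_n) (G : 'M[R]_n) :
  r *m complexify G =
    complexify (map_mx (@complex.Re R) r *m G)
      + 'i *: complexify (map_mx (@complex.Im R) r *m G).
Proof.
apply/rowP => j; rewrite !mxE /= !rmorph_sum mulr_sumr -big_split /=.
apply: eq_bigr => l _; rewrite !mxE /=; case: (r 0 l) => a b /=.
by apply/eqP; rewrite eq_complex /=; apply/andP; split; apply/eqP;
  rewrite ?(mul0r, mulr0, mul1r, addr0, add0r, subr0).
Qed.

Section MeasurePower.
Context d (T : measurableType d) (R : realType).
Variable mu : {sigma_finite_measure set T -> \bar R}.
Local Open Scope ereal_scope.

Definition cons_tuple n (z : n.-tuple T * T) : n.+1.-tuple T :=
  [tuple of z.2 :: z.1].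

Fact measurable_cons_tuple n :
  measurable_fun [set: n.-tuple T * T] (@cons_tuple n).
Proof.
by apply: measurable_cons; [exact: measurable_snd | exact: measurable_fst].
Qed.

(* The n-fold product measure, built as an iterated binary product carried
   over to tuples by [cons_tuple]; the generated name is the measure instance of
   [pushforward]. *)
Fixpoint measure_power n : {measure set (n.-tuple T) -> \bar R} :=
  match n with
  | 0 => \d_([tuple] : 0.-tuple T)
  | n'.+1 => measure_function_pushforward__canonical__measure_function_Measure
               (measure_power n' \x mu) (@measurable_cons_tuple n')
  end.

End MeasurePower.

Section RealLattices.
Variables (R : realType) (n : nat).
Implicit Types (L : set 'rV[R]_n) (x : 'rV[R]_n).

Definition real_lattice (G : 'M[R]_n) : set 'rV[R]_n :=
  [set x | exists z : 'rV[int]_n, x = map_mx intr z *m G].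

(* The norm that the library puts on matrices is the sup norm. *)
Definition enorm x : R := Num.sqrt (\sum_i x 0 i ^+ 2).

Definition row_of_tuple (t : n.-tuple (measurableTypeR R)) : 'rV[R]_n :=
  \row_i tnth t i.

Definition lebesgue_n : {measure set (n.-tuple (measurableTypeR R)) -> \bar R} :=
  measure_power (@lebesgue_measure R) n.

Definition volume (A : set 'rV[R]_n) : \bar R :=
  lebesgue_n (row_of_tuple @^-1` A).

Definition voronoi L : set 'rV[R]_n :=
  [set x | forall l, L l -> enorm x <= enorm (x - l)].

Definition lattice_volume L : R := fine (volume (voronoi L)).

Definition covering_radius L : R :=
  sup [set inf [set enorm (x - l) | l in L] | x in [set: 'rV[R]_n]].

(* The radius of the ball having the volume of the Voronoi region; it is unique
   for n > 0. *)
Definition effective_radius L : R :=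
  xget 0 [set r | 0 <= r /\
                  volume [set x | enorm x <= r] = volume (voronoi L)].

Definition second_moment L : R :=
  fine (\int[lebesgue_n]_(t in row_of_tuple @^-1` voronoi L)
          (enorm (row_of_tuple t) ^+ 2)%:E)
  / (n%:R * lattice_volume L).

Definition normalized_second_moment L : R :=
  second_moment L / lattice_volume L `^ (2 / n%:R).

(* Noise with i.i.d. N(0, s^2) coordinates. *)
Definition noise_error_prob L (s : R) : \bar R :=
  measure_power (normal_prob 0 s) n (row_of_tuple @^-1` (~` voronoi L)).

Definition volume_to_noise_ratio L (s : R) : R :=
  lattice_volume L `^ (2 / n%:R) / s ^+ 2.

End RealLattices.

Section Goodness.
Variables (R : realType) (dim : nat -> nat).
Variable L : forall j, set 'rV[R]_(dim j).

(* The j-th lattice lives in dimension [dim j]; these are meant for [dim] tending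
   to infinity. *)
Definition good_for_covering : Prop :=
  (fun j => covering_radius (@L j) / effective_radius (@L j)) @ \oo --> (1 : R).

Definition good_for_quantization : Prop :=
  (fun j => normalized_second_moment (@L j)) @ \oo --> (2 * pi * expR 1 : R)^-1.

Definition good_for_AWGN : Prop :=
  forall mu : R, 2 * pi * expR 1 < mu ->
  exists2 c : R, 0 < c &
    \forall j \near \oo, forall s : R, 0 < s ->
      volume_to_noise_ratio (@L j) s = mu ->
      (noise_error_prob (@L j) s <= (expR (- (c * (dim j)%:R)))%:E)%E.

End Goodness.

Section RandomMatrices.
Context d (T : measurableType d) (R : realType) (P : probability T R).

Definition mutually_independent (I : finType) (X : I -> T -> int) : Prop :=
  forall (S : {set I}) (A : I -> set int),
    (P (\bigcap_(i in [set` S]) X i @^-1` A i)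
     = \prod_(i in S) P (X i @^-1` A i))%E.

Definition uniform_below (p : nat) (X : T -> int) : Prop :=
  forall a : int, measurable (X @^-1` [set a]) /\
    P (X @^-1` [set a]) = (if 0 <= a < p%:Z then p%:R^-1 else 0)%:E.

Definition iid_uniform_entries (p m n : nat) (B : T -> 'M[int]_(m, n)) : Prop :=
  let entry (e : 'I_m * 'I_n) (w : T) := B w e.1 e.2 in
  (forall e, uniform_below p (entry e)) /\ mutually_independent entry.

End RandomMatrices.

(* Block matrix [A B; C D] with k + (n - k) rows and columns, cast to size n. *)
Definition nested_block (T : Type) (n k : nat) (kn : (k <= n)%N)
    (A : 'M[T]_k) (B : 'M[T]_(k, n - k)) (C : 'M[T]_(n - k, k))
    (D : 'M[T]_(n - k)) : 'M[T]_n :=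
  castmx (subnKC kn, subnKC kn) (block_mx A B C D).

Definition fine_generator (R : realType) (n k : nat) (kn : (k <= n)%N)
    (p : nat) (B : 'M[int]_(k, n - k)) (G' : 'M[R]_n) : 'M[R]_n :=
  p%:R^-1 *:
    (nested_block kn 1%:M (map_mx intr B) 0 (p%:R)%:M *m G').

Definition nested_J (n k : nat) (kn : (k <= n)%N)
    (p : nat) (B : 'M[int]_(k, n - k)) : 'M[int]_n :=
  nested_block kn (p%:R)%:M (- B) 0 1%:M.

(* Z[i]/(p) is a field with q elements, and the Z[i]-module L/L' is a vector
   space over it: its Z[i]-action factors through Z[i] -> Z[i]/(p). *)
Definition vector_space_over_field_of_size (R : realType) (n : nat)
    (G G' : 'M[R[i]]_n) (p : nat) (p_prime : prime p) (q : nat) : Prop :=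
  [/\ is_field (Zi_mod R p_prime),
      ([set: Zi_mod R p_prime] #= `I_q)%card
    & exists2 act : Zi_mod R p_prime -> lattice_quot G G' -> lattice_quot G G',
        is_module_action act
        & forall (a : Zi R) (v : lattice_quot G G'),
            act (Zi_mod_pi p_prime a) v = a *: v].

(* Main.v *)
(* Since G' = J G with G row-free, the coordinates r in Z[i]^n of a point r G of L
   are unique, and the point lies in L' exactly when r belongs to Z[i]^n J.  By the
   block form of J this means that the first k coordinates are divisible by p, so
   reducing them modulo p is a linear surjection of L onto (Z[i]/(p))^k with
   kernel L'.  Divisibility of m + n i by p is divisibility of m and of n, whence
   p^2 residue classes; a class is inverted by its conjugate over its norm.  For
   p = 3 mod 4, p divides a norm m^2 + n^2 only if it divides m and n, and
   multiplicativity of the norm makes p a prime of Z[i]. *)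

Require Import Defs.
From HB Require Import structures.
From mathcomp Require Import all_boot all_order all_algebra.
From mathcomp Require Import finfield complex ring.
From mathcomp Require Import all_classical all_reals all_analysis.

Set Implicit Arguments.
Unset Strict Implicit.
Unset Printing Implicit Defensive.

Import Order.TTheory GRing.Theory Num.Theory.
Import numFieldNormedType.Exports.

Local Open Scope classical_set_scope.
Local Open Scope ring_scope.
Local Open Scope complex_scope.

(** * Arithmetic of Z[i] in integer coordinates *)

Section GaussianArithmetic.
Variable R : realType.
Local Notation Zi := (Zi R).

Fact gauss_subproof (m n : int) :
  ((m%:~R : R) +i* (n%:~R : R)) \in @gaussian R.
Proof. by apply/andP; split; rewrite /= rpred_int. Qed.

Definition gauss (m n : int) : Zi := MkZi (gauss_subproof m n).

Lemma gaussP (z : Zi) : exists m n, z = gauss m n.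
Proof.
case: z => -[a b] /[dup] /andP[/intrP[m /= ->] /intrP[n /= ->]] zG.
by exists m, n; apply: val_inj.
Qed.

Lemma gauss_inj m n m' n' : gauss m n = gauss m' n' -> m = m' /\ n = n'.
Proof. by move=> /(congr1 val) [/intr_inj -> /intr_inj ->]. Qed.

Lemma gauss_natr p : gauss p%:Z 0 = p%:R.
Proof.
apply: val_inj; rewrite rmorph_nat /=.
by rewrite -[RHS](rmorph_nat (real_complex R)).
Qed.

Lemma gauss0 : gauss 0 0 = 0.
Proof. exact: (gauss_natr 0). Qed.

Lemma gauss1 : gauss 1 0 = 1.
Proof. exact: (gauss_natr 1). Qed.

Lemma gaussB m n m' n' : gauss m n - gauss m' n' = gauss (m - m') (n - n').
Proof. by apply: val_inj; rewrite rmorphB /= !intrB. Qed.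

Lemma gaussM m n m' n' :
  gauss m n * gauss m' n' = gauss (m * m' - n * n') (m * n' + n * m').
Proof. by apply: val_inj; rewrite rmorphM /= intrB intrD !intrM. Qed.

(** Since [p] is real, multiplication by it acts on each coordinate separately. *)
Lemma divides_gauss p m n :
  divides (p%:R : Zi) (gauss m n) <-> (p%:Z %| m)%Z /\ (p%:Z %| n)%Z.
Proof.
split=> [[c]|[/dvdzP[a ->] /dvdzP[b ->]]].
  have [a [b ->]] := gaussP c.
  rewrite -gauss_natr gaussM !(mulr0, subr0, add0r) => /gauss_inj[-> ->].
  by rewrite !dvdz_mull.
by exists (gauss a b); rewrite -gauss_natr gaussM !(mulr0, subr0, add0r).
Qed.

Lemma prime_dvdz_mul p (a b : int) : prime p ->
  (p%:Z %| a * b)%Z = (p%:Z %| a)%Z || (p%:Z %| b)%Z.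
Proof. by move=> p_pr; rewrite !dvdzE abszM Euclid_dvdM. Qed.

(* If [p] does not divide [b], then (a / b)^2 = -1 modulo [p], and the odd power
   (p - 1)/2 of this equation gives 1 = -1 by Fermat. *)
Lemma dvdz_sum_squares p (a b : int) : prime p -> p = 3 %[mod 4] ->
  (p%:Z %| a ^+ 2 + b ^+ 2)%Z -> (p%:Z %| a)%Z /\ (p%:Z %| b)%Z.
Proof.
move=> p_pr p3; have pF := pchar_Fp p_pr.
rewrite !(dvdz_pcharf pF) rmorphD !rmorphXn /=.
set x := a%:~R; set y := b%:~R => /eqP xy0.
have [y0|y_neq0] := eqVneq y 0.
  by move: xy0; rewrite y0 expr0n addr0 => /eqP; rewrite expf_eq0 /= => /eqP->.
have x2 : (x / y) ^+ 2 = -1.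
  rewrite expr_div_n; apply: (mulIf (expf_neq0 2 y_neq0)).
  by rewrite divfK ?expf_neq0 // mulN1r; apply/eqP; rewrite -addr_eq0 xy0.
have z_neq0 : x / y != 0.
  by apply: contra_eq_neq x2 => ->; rewrite expr0n eq_sym oppr_eq0 oner_eq0.
have pE : p = ((p %/ 4).*2.+1).*2.+1.
  by rewrite {1}(divn_eq p 4) p3 modn_small // -!muln2; ring.
have : (x / y) ^+ ((p %/ 4).*2.+1).*2.+1 = x / y.
  by rewrite -pE -[RHS]expf_card card_Fp.
rewrite exprS -muln2 mulnC exprM x2 -signr_odd /= odd_double /= => /eqP.
rewrite expr1 mulrN1 eq_sym -addr_eq0 -mulr2n -mulr_natr mulf_eq0.
rewrite (negPf z_neq0) /=.
(* There remains [2 = 0] modulo [p], so [p <= 2], which [p = 3 %[mod 4]] and [p > 1] exclude. *)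
rewrite -(dvdn_pcharf pF) => /(dvdn_leq _)-/(_ isT) p2; exfalso.
move: p3 p2 (prime_gt1 p_pr); clear; by case: p => [|[|[|]]].
Qed.

Lemma gauss_conjM m n : gauss m (- n) * gauss m n = gauss (m ^+ 2 + n ^+ 2) 0.
Proof. by rewrite gaussM; congr gauss; ring. Qed.

Lemma prime_element_gauss p : prime p -> p = 3 %[mod 4] ->
  prime_element (p%:R : Zi).
Proof.
move=> p_pr p3; split.
- apply/eqP; rewrite -gauss_natr -gauss0 => /gauss_inj[/eqP + _].
  by rewrite eqz_nat; case: (p) p_pr.
- rewrite -[X in divides _ X]gauss1 => /divides_gauss[+ _].
  by rewrite dvdzE /= dvdn1; case: (p) p_pr => [|[]].
move=> x y; have [a [b ->]] := gaussP x; have [c [e ->]] := gaussP y.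
rewrite gaussM => /divides_gauss[pre pim].
(* The product of the two norms is the norm of the product, whose coordinates [p] divides; hence [p]
   divides one of the two norms. *)
have : (p%:Z %| (a ^+ 2 + b ^+ 2) * (c ^+ 2 + e ^+ 2))%Z.
  have -> : (a ^+ 2 + b ^+ 2) * (c ^+ 2 + e ^+ 2) =
     (a * c - b * e) * (a * c - b * e) + (a * e + b * c) * (a * e + b * c).
    by ring.
  by rewrite rpredD // dvdz_mulr.
rewrite prime_dvdz_mul // => /orP[] /(dvdz_sum_squares p_pr p3)/divides_gauss.
  by left.
by right.
Qed.

(** * The residue ring Z[i]/(p) *)

Section ModP.
Variables (p : nat) (p_prime : prime p).
Local Notation Zi_mod := (Zi_mod R p_prime).
Local Notation pi := (@Zi_mod_pi R p p_prime).

Lemma Zi_mod_pi_surj (x : Zi_mod) : exists a, x = pi a.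
Proof.
by exists (repr (x : {ideal_quot (zi_ideal p_prime)})); rewrite /Zi_mod_pi reprK.
Qed.

Lemma Zi_mod_pi_eq a b : pi a = pi b <-> divides (p%:R : Zi) (a - b).
Proof.
have pi_eqE : (pi a == pi b) = (a - b \in zi_ideal p_prime).
  by rewrite Quotient.idealrBE.
split=> [/eqP | pab]; first by rewrite pi_eqE => /asboolP.
by apply/eqP; rewrite pi_eqE; apply/asboolP.
Qed.

Lemma Zi_mod_pi_eq0 a : pi a = 0 <-> divides (p%:R : Zi) a.
Proof.
rewrite -[0](rmorph0 pi) -[X in divides _ X]subr0; exact: Zi_mod_pi_eq.
Qed.

(* A nonzero class [x] is inverted by its conjugate over its norm; were [p] to
   divide the norm, primality of [p] would make it divide [x]. *)
Lemma Zi_mod_field : prime_element (p%:R : Zi) -> is_field Zi_mod.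
Proof.
move=> [_ _ p_el] x; have [z ->] := Zi_mod_pi_surj x.
have [a [b ->]] := gaussP z => /eqP zn0.
have npN : ~ (p%:Z %| a ^+ 2 + b ^+ 2)%Z.
  move=> pN; apply: zn0; apply/Zi_mod_pi_eq0/divides_gauss.
  have : divides (p%:R : Zi) (gauss a (- b) * gauss a b).
    by rewrite gauss_conjM; apply/divides_gauss.
  by case/p_el => /divides_gauss; rewrite ?rpredN.
have /coprimezP[[u v] /= uv] : coprimez (a ^+ 2 + b ^+ 2) p%:Z.
  by rewrite coprimezE coprime_sym prime_coprime //; apply/negP.
exists (pi (gauss u 0 * gauss a (- b))).
rewrite -rmorphM -mulrA gauss_conjM -[1](rmorph1 pi); apply/Zi_mod_pi_eq.
rewrite gaussM -[X in _ - X]gauss1 gaussB; apply/divides_gauss.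
rewrite !(mulr0, mul0r, subr0, add0r, dvdz0); split=> //.
by rewrite -uv opprD addrA subrr add0r rpredN dvdz_mull.
Qed.

(** The two base-[p] digits of a number below [p ^ 2] serve as the coordinates of a residue
    class. *)
Lemma card_Zi_mod : ([set: Zi_mod] #= `I_(p ^ 2))%card.
Proof.
have p_gt0 := prime_gt0 p_prime.
pose f m : Zi_mod := pi (gauss (m %/ p)%N (m %% p)%N).
have dvd_lt m n : (m < p)%N -> (n < p)%N -> (p%:Z %| m%:Z - n%:Z)%Z -> m = n.
  move=> mp np; rewrite -eqz_mod_dvd !modz_nat eqz_nat => /eqP.
  by rewrite !modn_small.
suff -> : [set: Zi_mod] = f @` `I_(p ^ 2).
  apply: inj_card_eq => m n; rewrite !inE /= => mlt nlt /Zi_mod_pi_eq.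
  have lt_div l : (l < p ^ 2)%N -> (l %/ p < p)%N.
    by rewrite ltn_divLR // mulnn.
  rewrite gaussB => /divides_gauss[/dvd_lt q /dvd_lt r].
  rewrite (divn_eq m p) (divn_eq n p) (q (lt_div _ mlt) (lt_div _ nlt)).
  by rewrite r // ltn_mod.
apply/seteqP; split=> // x _; have [z ->] := Zi_mod_pi_surj x.
have [a [b ->]] := gaussP z.
have pZ0 : p%:Z != 0 by rewrite eqz_nat -lt0n.
(* Reducing each coordinate to its remainder in [0, p) keeps the class and produces the two digits
   as natural numbers. *)
have [m [mlt am]] : exists m, (m < p)%N /\ (a %% p)%Z = m%:Z.
  exists `|(a %% p)%Z|%N; rewrite gez0_abs ?modz_ge0 //; split=> //.
  by rewrite -ltz_nat gez0_abs ?modz_ge0 // ltz_pmod.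
have [n [nlt bn]] : exists n, (n < p)%N /\ (b %% p)%Z = n%:Z.
  exists `|(b %% p)%Z|%N; rewrite gez0_abs ?modz_ge0 //; split=> //.
  by rewrite -ltz_nat gez0_abs ?modz_ge0 // ltz_pmod.
exists (m * p + n)%N => /=.
  by rewrite -mulnn -ltn_divLR // divnMDl // divn_small // addn0.
apply/Zi_mod_pi_eq; rewrite gaussB; apply/divides_gauss.
rewrite divnMDl // divn_small // addn0 modnMDl modn_small // -am -bn.
by rewrite -!eqz_mod_dvd !modz_mod.
Qed.

End ModP.
End GaussianArithmetic.

(** * The first isomorphism theorem for modules *)

Lemma module_quot_iso (A : pzRingType) (V W : lmodType A) (N : submodClosed V)
    (g : {linear V -> W}) (g_ker : forall v, (v \in N) = (g v == 0))
    (g_surj : forall w, exists v, g v = w) :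
  exists f : {linear module_quot N -> W}, bijective f.
Proof.
have rep_ex (q : module_quot N) : {v | q = module_pi N v}.
  exact: (cid (module_pi_surj q)).
(* A class is sent to the image of a chosen representative; [f_pi] shows that the choice does not
   matter, since representatives differ by an element of the kernel. *)
pose f (q : module_quot N) : W := g (sval (rep_ex q)).
have f_pi v : f (module_pi N v) = g v.
  rewrite /f; case: (rep_ex _) => u /= /eqP.
  by rewrite module_pi_eqE g_ker linearB subr_eq0 => /eqP.
have f_zmod : zmod_morphism f.
  move=> q r; case: (module_pi_surj q) (module_pi_surj r) => u -> [v ->].
  have -> : module_pi N u - module_pi N v = module_pi N (u - v).
    by apply/eqP; rewrite subr_eq -module_pi_is_additive subrK.
  by rewrite !f_pi linearB.
have f_scal : scalable f.
  move=> a q; case: (module_pi_surj q) => u ->.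
  by rewrite -[_ *: _]/(module_quot_scale a _) module_piZ !f_pi linearZ.
pose fL : {linear module_quot N -> W} :=
  HB.pack f (GRing.isZmodMorphism.Build _ _ f f_zmod)
            (GRing.isScalable.Build _ _ _ _ f f_scal).
exists fL; have [h hK] := choice g_surj.
exists (fun w => module_pi N (h w)) => [q | w]; last first.
  exact: etrans (f_pi _) (hK w).
have [u ->] := module_pi_surj q; apply/eqP.
by rewrite module_pi_eqE g_ker linearB hK subr_eq0 [fL _]f_pi.
Qed.

(** * The block matrices of the construction *)

Section NestedMatrices.
Variables (A : comNzRingType) (k m n : nat) (e : (k + m)%N = n).
Implicit Types (B : 'M[A]_(k, m)) (q : A).

(** With [q = p], dividing this identity by [p] gives G' = J G. *)
Lemma nested_mxM B q :
  castmx (e, e) (block_mx q%:M (- B) 0 1%:M) *m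
  castmx (e, e) (block_mx 1%:M B 0 q%:M) = q%:M.
Proof.
case: n / e; rewrite !castmx_id mulmx_block !(mulmx1, mul1mx, mulmx0, mul0mx).
rewrite !(addr0, add0r) mulNmx mul_mx_scalar mul_scalar_mx.
by rewrite subrr scalar_mx_block.
Qed.

Lemma nested_mx_range B q (r : 'rV[A]_n) :
  (exists s, r = s *m castmx (e, e) (block_mx q%:M (- B) 0 1%:M)) <->
  (forall a : 'I_k, divides q (r 0 (cast_ord e (lshift m a)))).
Proof.
case: n / e r => r; rewrite castmx_id; split=> [[s ->] a | qr].
  rewrite -[s]hsubmxK mul_row_block cast_ord_id row_mxEl.
  rewrite mulmx0 addr0 mul_mx_scalar mxE.
  by exists (lsubmx s 0 a); rewrite mulrC.
have {qr}[c rc] := choice qr.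
(* The first block of the witness collects the quotients by [q]. The block [- B] then contributes
   [- (u *m B)] to the last coordinates, which the summand [u *m B] cancels. *)
pose u : 'rV_k := \row_a c a; exists (row_mx u (rsubmx r + u *m B)).
rewrite mul_row_block mulmx0 addr0 mul_mx_scalar mulmx1 mulmxN addrCA addNr addr0.
rewrite -[LHS]hsubmxK; congr row_mx; apply/rowP => a.
by rewrite !mxE mulrC -rc cast_ord_id.
Qed.

End NestedMatrices.

(** * Coordinates on a lattice and the structure of the quotient *)

Section LatticeQuotient.
Variables (R : realType) (n : nat) (G : 'M[R[i]]_n).
Hypothesis G_free : row_free G.
Local Notation Zi := (Zi R).

Lemma lattice_coord_subproof (x : lattice_module G) :
  {r : 'rV[Zi]_n | lattice_vec x = map_mx val r *m G}.
Proof. by apply: cid; apply/asboolP; exact: (valP x). Qed.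

Definition lattice_coord x : 'rV[Zi]_n := sval (lattice_coord_subproof x).

Lemma lattice_coordE x : lattice_vec x = map_mx val (lattice_coord x) *m G.
Proof. exact: (svalP (lattice_coord_subproof x)). Qed.

Lemma lattice_coord_inj (r s : 'rV[Zi]_n) :
  map_mx val r *m G = map_mx val s *m G -> r = s.
Proof.
by move/(row_free_inj G_free) => /rowP rs; apply/rowP => i; apply: val_inj;
  move: (rs i); rewrite !mxE.
Qed.

Lemma lattice_coord_unique (x : lattice_module G) r :
  lattice_vec x = map_mx val r *m G -> lattice_coord x = r.
Proof. by rewrite lattice_coordE => /lattice_coord_inj. Qed.

Lemma lattice_coord_surj r : exists x, lattice_coord x = r.
Proof.
have rG : map_mx val r *m G \in zi_span G by apply/asboolP; exists r.
by exists (LatticeModule rG); apply: lattice_coord_unique.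
Qed.

(** The coordinates are picked by choice; their uniqueness, from the row-freeness of [G], forces
    linearity. *)
Fact lattice_coord_is_linear : linear lattice_coord.
Proof.
move=> a x y; apply: lattice_coord_unique.
rewrite map_mxD map_mxZ mulmxDl -scalemxAl -!lattice_coordE.
exact: (linearP (val : lattice_module G -> cvec R n)).
Qed.

HB.instance Definition _ := GRing.isLinear.Build Zi (lattice_module G)
  'rV[Zi]_n *:%R lattice_coord lattice_coord_is_linear.

(** In coordinates the sublattice becomes the row span of [M] over Z[i], which [nested_mx_range]
    describes when [M] is J. *)
Lemma inner_latticeE (M : 'M[Zi]_n) (x : lattice_module G) :
  (x \in inner_lattice (map_mx val M *m G)) <->
  (exists s, lattice_coord x = s *m M).
Proof.
rewrite -[_ \in _]/(val x \in zi_span _); split=> [/asboolP[s xE]|[s xE]].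
  by exists s; apply: lattice_coord_unique; rewrite [LHS]xE map_mxM mulmxA.
by apply/asboolP; exists s; rewrite [LHS]lattice_coordE xE map_mxM mulmxA.
Qed.

Lemma lattice_quot_iso k m (e : (k + m)%N = n) (B : 'M[Zi]_(k, m)) p
    (p_prime : prime p) :
  exists f : {linear
    lattice_quot G
      (map_mx val (castmx (e, e) (block_mx p%:R%:M (- B) 0 1%:M)) *m G)
    -> {ffun 'I_k -> Zi_mod R p_prime}}, bijective f.
Proof.
set J := castmx _ _.
pose g (x : lattice_module G) : {ffun 'I_k -> Zi_mod R p_prime} :=
  [ffun a => Zi_mod_pi p_prime (lattice_coord x 0 (cast_ord e (lshift m a)))].
have g_lin : linear g.
  by move=> a x y; apply/ffunP => b; rewrite !ffunE linearP !mxE rmorphD rmorphM.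
pose gL : {linear lattice_module G -> {ffun 'I_k -> Zi_mod R p_prime}} :=
  HB.pack g (GRing.isLinear.Build _ _ _ _ g g_lin).
apply: (module_quot_iso (g := gL)) => [x | w].
  apply/idP/eqP => [/inner_latticeE/nested_mx_range xJ | /ffunP gx0].
    by apply/ffunP => a; rewrite !ffunE; apply/Zi_mod_pi_eq0.
  apply/inner_latticeE/nested_mx_range => a.
  by move: (gx0 a); rewrite !ffunE => /Zi_mod_pi_eq0.
(* Surjectivity: lift each residue to Z[i] and pad the last coordinates with zeros. *)
have [c wc] := choice (fun a => Zi_mod_pi_surj (w a)).
have [x xE] := lattice_coord_surj (castmx (erefl, e) (row_mx (\row_a c a) 0)).
exists x; apply/ffunP => a; rewrite ffunE xE wc castmxE /= cast_ordK row_mxEl.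
by rewrite mxE.
Qed.

End LatticeQuotient.

(** The isomorphism turns the action of [a] into multiplication by its class, so a class can act
    through any of its representatives. *)
Lemma vector_space_lattice_quot (R : realType) (n k : nat) (G G' : 'M[R[i]]_n)
    p (p_prime : prime p)
    (f : {linear lattice_quot G G' -> {ffun 'I_k -> Zi_mod R p_prime}}) :
  bijective f -> prime_element (p%:R : Zi R) ->
  vector_space_over_field_of_size G G' p_prime (p ^ 2).
Proof.
move=> /bij_inj f_inj p_el; split.
- exact: Zi_mod_field.
- exact: card_Zi_mod.
have [rep repK] := choice (@Zi_mod_pi_surj R p p_prime).
have pi_act a b (v : lattice_quot G G') :
    Zi_mod_pi p_prime a = Zi_mod_pi p_prime b -> a *: v = b *: v.
  move=> ab; apply: f_inj; rewrite !linearZ; apply/ffunP => i.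
  by rewrite !ffunE /= -[LHS]/(Zi_mod_pi p_prime a * _) ab.
exists (fun x v => rep x *: v); last by move=> a v; apply: pi_act; rewrite -repK.
split=> [a b v | v | a u v | a b v].
- by rewrite scalerA; apply: pi_act; rewrite rmorphM /= -!repK.
- by rewrite -[RHS]scale1r; apply: pi_act; rewrite rmorph1 -repK.
- exact: scalerDr.
- by rewrite -scalerDl; apply: pi_act; rewrite rmorphD /= -!repK.
Qed.

(** * The identity G' = J G over the reals and over Z[i], and the theorem *)

Lemma nested_J_mx (A : pzRingType) k m n (e : (k + m)%N = n) p
    (B : 'M[int]_(k, m)) :
  map_mx intr (castmx (e, e) (block_mx (p%:R)%:M (- B) 0 1%:M)) =
  castmx (e, e) (block_mx (p%:R)%:M (- map_mx intr B) 0 1%:M) :> 'M[A]_n.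
Proof.
rewrite map_castmx map_block_mx map_mxN map_mx0 !map_scalar_mx.
by rewrite rmorph_nat rmorph1.
Qed.

Lemma nested_J_fine_generator (R : realType) n k (kn : (k <= n)%N) p
    (B : 'M[int]_(k, n - k)) (G' : 'M[R]_n) : prime p ->
  G' = map_mx intr (nested_J kn p B) *m fine_generator kn p B G'.
Proof.
move=> p_prime; have p_neq0 : p%:R != 0 :> R by rewrite pnatr_eq0 -lt0n prime_gt0.
rewrite nested_J_mx -scalemxAr mulmxA nested_mxM mul_scalar_mx scalerA.
by rewrite mulVf // scale1r.
Qed.

(** [G'] is invertible and has the fine generator as a factor, so that factor is invertible too. *)
Lemma row_free_fine_generator (R : realType) n k (kn : (k <= n)%N) p
    (B : 'M[int]_(k, n - k)) (G' : 'M[R]_n) : prime p -> row_free G' ->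
  row_free (fine_generator kn p B G').
Proof.
move=> p_prime; rewrite !row_free_unit.
rewrite {1}(nested_J_fine_generator kn B G' p_prime).
by rewrite unitmx_mul => /andP[].
Qed.

(** Here J has its entries in Z[i], the form of the coarse generator that [lattice_quot_iso]
    expects. *)
Lemma complexify_nested_J (R : realType) n k (kn : (k <= n)%N) p
    (B : 'M[int]_(k, n - k)) (G' : 'M[R]_n) : prime p ->
  complexify G' =
  map_mx val (map_mx intr (nested_J kn p B) : 'M[Zi R]_n) *m
  complexify (fine_generator kn p B G').
Proof.
move=> p_prime; rewrite {1}(nested_J_fine_generator kn B G' p_prime).
rewrite /complexify map_mxM; congr (_ *m _).
by apply/matrixP => a b; rewrite !mxE !rmorph_int.
Qed.

Theorem mainTheorem3 (R : realType)
    (dim : nat -> nat) (Gs : forall j, 'M[R]_(dim j))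
    (dim_gt0 : forall j, (0 < dim j)%N)
    (dim_grows : dim @ \oo --> \oo)
    (Gs_free : forall j, row_free (Gs j))
    (covering_good : good_for_covering (fun j => real_lattice (Gs j)))
    (quantization_good : good_for_quantization (fun j => real_lattice (Gs j)))
    (AWGN_good : good_for_AWGN (fun j => real_lattice (Gs j)))
    (j k : nat) (k_gt0 : (0 < k)%N) (kn : (k <= dim j)%N)
    (p : nat) (p_prime : prime p)
    (d : measure_display) (Omega : measurableType d) (P : probability Omega R)
    (B : Omega -> 'M[int]_(k, dim j - k))
    (B_iid : iid_uniform_entries P p B)
    (w : Omega) :
  let G' : 'M[R]_(dim j) := Gs j in
  let G : 'M[R]_(dim j) := fine_generator kn p (B w) G' in
  let J : 'M[int]_(dim j) := nested_J kn p (B w) in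
  let L' := zi_span (complexify G') in
  let L := zi_span (complexify G) in
  [/\ G' = map_mx intr J *m G,
      forall a b, (J a b)%:~R \in @gaussian R
    & is_zi_lattice L /\ is_zi_sublattice L' L]
  /\
  [/\ exists f : {linear lattice_quot (complexify G) (complexify G')
                    -> {ffun 'I_k -> Zi_mod R p_prime}},
        bijective f,
      prime_element (p%:R : Zi R) ->
        vector_space_over_field_of_size (complexify G) (complexify G')
          p_prime (p ^ 2)
    & p = 3 %[mod 4] ->
        prime_element (p%:R : Zi R) /\
        vector_space_over_field_of_size (complexify G) (complexify G')
          p_prime (p ^ 2)].
Proof.
move=> G' G J L' L.
have G'_free : row_free (complexify G') by rewrite row_free_map.
have G_free : row_free (complexify G).
  by rewrite row_free_map row_free_fine_generator.
have G'E := complexify_nested_J kn (B w) G' p_prime.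
have [f f_bij] : exists f : {linear lattice_quot (complexify G) (complexify G')
    -> {ffun 'I_k -> Zi_mod R p_prime}}, bijective f.
  by rewrite G'E nested_J_mx; exact: lattice_quot_iso.
have vect := vector_space_lattice_quot f_bij.
split; last first.
  split=> [|//|p3]; first by exists f.
  by have p_el := prime_element_gauss R p_prime p3; split=> //; exact: vect.
split; first exact: nested_J_fine_generator.
  by move=> a b; rewrite rpred_int.
split; first by exists (complexify G).
split; first by exists (complexify G').
(* A point r G' of L' equals (r J) G, with r J in Z[i]^n. *)
move=> x /asboolP[r ->]; apply/asboolP.
by exists (r *m map_mx intr J); rewrite [in RHS]map_mxM -mulmxA G'E.
Qed.
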